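(* Every hypergraph $\mathcal{H}$ is line-equivalent to a reduced hypergraph.
   Context: A hypergraph $\mathcal{H}=(V,E)$ consists of a finite set $V$ of vertices and a set $E$ of non-empty subsets of $V$, called hyperedges. All hypergraphs are assumed simple (no hyperedge has cardinality one and no hyperedge is contained in another) and connected (any two vertices are joined by a path, i.e. an alternating sequence of distinct vertices and hyperedges in which each hyperedge contains the vertices immediately before and after it). The degree $d_{\mathcal{H}}(v)$ of a vertex $v$ is the number of hyperedges containing $v$. Two hypergraphs $\mathcal{H}_1$ and $\mathcal{H}_2$ are line-equivalent if there exists a bijection $\varphi:E(\mathcal{H}_1)\to E(\mathcal{H}_2)$ such that $|e\cap f|=|\varphi(e)\cap\varphi(f)|$ for all distinct $e,f\in E(\mathcal{H}_1)$; equivalently, $\varphi$ extends to an isomorphism of the line multigraphs $\mathcal{L}(\mathcal{H}_1)$ and $\mathcal{L}(\mathcal{H}_2)$, where $\mathcal{L}(\mathcal{H})$ is the multigraph with vertex set $E(\mathcal{H})$ in which two distinct vertices $e,f$ are joined by exactly $|e\cap f|$ edges. A hypergraph $\mathcal{H}$ is reduced if no hyperedge $e\in E(\mathcal{H})$ with $|e|\geq3$ admits a vertex $v\in e$ with $d_{\mathcal{H}}(v)=1$ such that $e\setminus\{v\}$ is not contained in any other hyperedge of $\mathcal{H}$. *)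

(* Defs.v *)
From HB Require Import structures.
From mathcomp Require Import all_boot.
Set Implicit Arguments.
Unset Strict Implicit.
Unset Printing Implicit Defensive.

Record hypergraph := Hypergraph {
  vertex : finType;
  edges : {set {set vertex}};
  edges_nonempty : set0 \notin edges }.

Definition edge (H : hypergraph) : Type := {e : {set vertex H} | e \in edges H}.

Definition degree (H : hypergraph) (v : vertex H) : nat :=
  #|[set e in edges H | v \in e]|.

Definition simple (H : hypergraph) : Prop :=
  (forall e, e \in edges H -> #|e| != 1) /\
  (forall e f, e \in edges H -> f \in edges H -> e != f -> ~~ (e \subset f)).

(* [:: (e1, v1); ...; (ek, vk)] encodes the alternating sequence
   x, e1, v1, ..., ek, vk. *)
Fixpoint hwalk (H : hypergraph) (x : vertex H)
    (p : seq ({set vertex H} * vertex H)) : bool :=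
  if p is (e, y) :: p' then
    [&& e \in edges H, x \in e, y \in e & hwalk y p']
  else true.

Definition hpath (H : hypergraph) (x y : vertex H)
    (p : seq ({set vertex H} * vertex H)) : bool :=
  [&& hwalk x p, last x (unzip2 p) == y, uniq (x :: unzip2 p)
    & uniq (unzip1 p)].

Definition connected (H : hypergraph) : Prop :=
  forall x y : vertex H, exists p, hpath x y p.

Definition line_equivalent (H1 H2 : hypergraph) : Prop :=
  exists phi : edge H1 -> edge H2,
    bijective phi /\
    forall e f : edge H1, e != f ->
      #|val e :&: val f| = #|val (phi e) :&: val (phi f)|.

Definition reduced (H : hypergraph) : Prop :=
  ~ exists e : {set vertex H}, exists v : vertex H,
      [/\ e \in edges H, 3 <= #|e|, v \in e, degree v = 1 &
          forall f, f \in edges H -> f != e -> ~~ (e :\ v \subset f)].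

(* Main.v *)
(** As long as [H] is not reduced, delete a vertex [v] witnessing this. Since
    [v] has degree 1, no two hyperedges meet in [v], so all intersection sizes
    are preserved, and no path enters and leaves [v] through distinct
    hyperedges, so connectedness is preserved. The hyperedge losing [v] keeps at
    least two vertices and is, by the choice of [v], still contained in no
    other. The number of vertices decreases, so this process stops. *)
Require Import Defs.
From HB Require Import structures.
From mathcomp Require Import all_boot.
Set Implicit Arguments.
Unset Strict Implicit.
Unset Printing Implicit Defensive.

Lemma line_equivalent_refl (H : hypergraph) : line_equivalent H H.
Proof. by exists id; split=> //; exists id. Qed.

Lemma line_equivalent_trans (H1 H2 H3 : hypergraph) :
  line_equivalent H1 H2 -> line_equivalent H2 H3 -> line_equivalent H1 H3.
Proof.
move=> [f [bij_f fP]] [g [bij_g gP]]; exists (g \o f).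
split=> [|e1 e2 e12]; first exact: bij_comp.
by rewrite (fP _ _ e12) gP // (inj_eq (bij_inj bij_f)).
Qed.

Section Trace.
Variables (T : finType) (v : T).

(** Deleting [v] changes the vertex type, so [f :\ v] is transported to the subtype of vertices
    other than [v]. *)
Definition trace (f : {set T}) : {set {x : T | x != v}} := val @^-1: f.

Lemma imset_val_trace f : val @: trace f = f :\ v.
Proof.
apply/setP=> x; rewrite !inE; apply/imsetP/andP=> [[y + ->]|[xv xf]].
  by rewrite inE; split=> //; exact: (valP y).
by exists (Sub x xv); rewrite ?inE SubK.
Qed.

Lemma card_trace f : #|trace f| = #|f :\ v|.
Proof. by rewrite -imset_val_trace (card_imset _ val_inj). Qed.

Lemma subset_trace f g : (trace f \subset trace g) = (f :\ v \subset g).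
Proof. by rewrite -imset_val_trace sub_imset_pre. Qed.

End Trace.

Section DeleteVertex.
Variables (H : hypergraph) (e : {set vertex H}) (v : vertex H).
Hypotheses (simpleH : simple H) (connectedH : connected H).
Hypotheses (eH : e \in edges H) (e_ge3 : 3 <= #|e|) (ve : v \in e).
Hypotheses (degv : degree v = 1)
  (e_max : forall f, f \in edges H -> f != e -> ~~ (e :\ v \subset f)).

Let edge_unique f : f \in edges H -> v \in f -> f = e.
Proof.
move=> fH vf; have /eqP/cards1P[g defg] := degv.
have : e \in [set f in edges H | v \in f] by rewrite inE eH.
have : f \in [set f in edges H | v \in f] by rewrite inE fH.
by rewrite defg !inE => /eqP-> /eqP->.
Qed.

Let setD1_notin f : f \in edges H -> f != e -> f :\ v = f.
Proof.
move=> fH fe; apply/setDidPl; rewrite disjoint_sym disjoints1.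
by apply: contra_neqN fe; apply: edge_unique.
Qed.

(** For [f = e] this is the choice of [v]. Any other [f] avoids [v], so an inclusion of traces would
    give [f \subset g], against simplicity. *)
Let trace_antichain f g :
  f \in edges H -> g \in edges H -> f != g -> ~~ (trace v f \subset trace v g).
Proof.
move=> fH gH fg; rewrite subset_trace; case: (eqVneq f e) => [fe|fe].
  by rewrite fe; apply: e_max; rewrite // -fe eq_sym.
by rewrite setD1_notin //; case: simpleH => _; apply.
Qed.

Let trace_inj : {in edges H &, injective (trace v)}.
Proof.
move=> f g fH gH fg; apply/eqP; apply: contraT => /(trace_antichain fH gH).
by rewrite fg subxx.
Qed.

Let card_trace_gt1 f : f \in edges H -> 1 < #|trace v f|.
Proof.
move=> fH; rewrite card_trace; case: (eqVneq f e) => [->|fe].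
  by move: e_ge3; rewrite (cardsD1 v) ve.
rewrite setD1_notin // ltn_neqAle eq_sym (proj1 simpleH) //= card_gt0.
by apply: contraTneq fH => ->; apply: edges_nonempty.
Qed.

(** If [v] were a common vertex, both [f] and [g] would be [e]. *)
Let card_trace_cap f g : f \in edges H -> g \in edges H -> f != g ->
  #|trace v f :&: trace v g| = #|f :&: g|.
Proof.
move=> fH gH fg; rewrite -preimsetI card_trace; apply: eq_card => x.
rewrite in_setD1; case: (eqVneq x v) => //= ->; rewrite inE.
by apply/esym/andP=> -[/(edge_unique fH) fe /(edge_unique gH) ge];
   rewrite fe ge eqxx in fg.
Qed.

Let delete_nonempty : set0 \notin [set trace v f | f in edges H].
Proof.
by apply/imsetP=> -[f /card_trace_gt1 + f0]; rewrite -f0 cards0.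
Qed.

Definition delete_vertex := Hypergraph delete_nonempty.

Lemma card_delete_vertex : #|vertex delete_vertex| < #|vertex H|.
Proof.
rewrite /= card_sig [in X in _ < X](cardD1 v) inE add1n ltnS.
by apply: subset_leq_card; apply/subsetP=> x; rewrite !inE andbT.
Qed.

Lemma delete_vertex_simple : simple delete_vertex.
Proof.
split=> [_ /imsetP[f fH ->]|_ _ /imsetP[f fH ->] /imsetP[g gH ->] fg].
  by rewrite neq_ltn card_trace_gt1 ?orbT.
by apply: trace_antichain => //; apply: contraNneq fg => ->.
Qed.

Lemma delete_vertex_line_equivalent : line_equivalent H delete_vertex.
Proof.
have trace_edge (f : edge H) : trace v (val f) \in edges delete_vertex.
  by apply: imset_f; apply: (valP f).
pose phi (f : edge H) : edge delete_vertex := Sub (trace v (val f)) (trace_edge f).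
exists phi; split=> [|f g fg]; last first.
  by rewrite card_trace_cap //; [apply: (valP f) | apply: (valP g)].
apply: inj_card_bij => [f g /(congr1 val) /= fg|].
  by apply: val_inj; apply: trace_inj fg; [apply: (valP f) | apply: (valP g)].
(* Surjectivity by counting: the new hyperedges are the image of [edges H] under a map injective
   there. *)
by rewrite !card_sig -(card_in_imset trace_inj) subset_leq_card.
Qed.

(** Since [v] is not an end, a visit to it lies between two consecutive hyperedges containing [v].
    Both equal [e], but the hyperedges of a path are distinct. *)
Let path_avoids x p : hwalk x p -> uniq (unzip1 p) -> x != v ->
  last x (unzip2 p) != v -> all (predC1 v) (unzip2 p).
Proof.
elim: p x => //= -[f y] p IHp x /= /and4P[fH xf yf walk] /andP[fp up] xv lastv.
case: (eqVneq y v) => [yv|yv] /=; last exact: IHp walk up yv lastv.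
case: p fp walk lastv {IHp up} => [_ _|[g z] p]; first by rewrite yv /= eqxx.
rewrite /= inE negb_or yv => /andP[fg _] /and4P[gH vg _ _].
by rewrite yv in yf; rewrite (edge_unique fH yf) (edge_unique gH vg) eqxx in fg.
Qed.

(** The two equations carry the end point and the distinctness of vertices and hyperedges over from
    [p] to [q]. *)
Let walk_restrict (x : vertex delete_vertex) p :
    hwalk (val x) p -> all (predC1 v) (unzip2 p) ->
  exists q, [/\ hwalk x q, map val (unzip2 q) = unzip2 p
              & unzip1 q = map (trace v) (unzip1 p)].
Proof.
elim: p x => [|[f y] p IHp] x /=; first by exists [::].
move=> /and4P[fH xf yf walk] /andP[yv pv].
have [q [wq q2 q1]] := IHp (Sub y yv) walk pv.
exists ((trace v f, Sub y yv) :: q); split; rewrite /= ?q2 ?q1 //.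
by rewrite wq andbT imset_f // !inE xf.
Qed.

(** Needed because [trace v] is injective on hyperedges but not on arbitrary sets of vertices. *)
Let walk_edges x (p : seq ({set vertex H} * vertex H)) :
  hwalk x p -> {subset unzip1 p <= edges H}.
Proof.
elim: p x => //= -[f y] p IHp x /= /and4P[fH _ _ walk] g.
by rewrite inE => /predU1P[->|] //; apply: IHp walk g.
Qed.

Lemma delete_vertex_connected : connected delete_vertex.
Proof.
move=> x y; have [p /and4P[walk /eqP last_p uniq2 uniq1]] :=
  connectedH (val x) (val y).
have pv : all (predC1 v) (unzip2 p).
  by apply: path_avoids walk uniq1 (valP x) _; rewrite last_p; apply: (valP y).
have [q [wq q2 q1]] := walk_restrict walk pv.
exists q; apply/and4P; split=> //.
- by rewrite -(inj_eq val_inj) -last_map q2 last_p.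
- by rewrite -(map_inj_uniq val_inj) /= q2.
- rewrite q1 map_inj_in_uniq // => f g /(walk_edges walk) fH.
  by move=> /(walk_edges walk); apply: trace_inj.
Qed.

End DeleteVertex.

Theorem theorem3p20 (H : hypergraph) (simpleH : simple H)
    (connectedH : connected H) :
  exists H' : hypergraph,
    [/\ simple H', connected H', reduced H' & line_equivalent H H'].
Proof.
have [n] := ubnP #|vertex H|.
elim: n H simpleH connectedH => // n IHn H simpleH connectedH; rewrite ltnS => ltn.
(* A boolean form of [reduced]: all quantifiers range over finite types, so a failure yields an
   explicit pair [e], [v]. *)
have [redH|nredH] := boolP [forall e : {set vertex H}, forall v : vertex H,
  ~~ [&& e \in edges H, 3 <= #|e|, v \in e, degree v == 1 &
      [forall f in edges H, (f != e) ==> ~~ (e :\ v \subset f)]]].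
  exists H; split=> //; last exact: line_equivalent_refl.
  move=> [e [v [eH e3 ve dv e_max]]].
  move/forallP/(_ e)/forallP/(_ v)/negP: redH; apply.
  rewrite eH e3 ve dv /=; apply/forall_inP=> f fH; apply/implyP; exact: e_max.
move: nredH; rewrite negb_forall => /existsP[e].
rewrite negb_forall => /existsP[v].
rewrite negbK => /and5P[eH e3 ve /eqP dv /forall_inP e_max].
have {}e_max f : f \in edges H -> f != e -> ~~ (e :\ v \subset f).
  by move=> /e_max/implyP.
have [|||H' [sH' cH' rH' eqH']] := IHn (delete_vertex simpleH eH e3 ve dv).
- exact: delete_vertex_simple.
- exact: delete_vertex_connected.
- exact: leq_trans (card_delete_vertex _ _ _ _ _) ltn.
exists H'; split=> //; apply: line_equivalent_trans eqH'.
exact: delete_vertex_line_equivalent.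
Qed.
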